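(* For every integer $k\ge 1$ let $C_k=\{n\ge 1: h(n)\le k\}$ and $D_k=\{n\ge 1: h(n)=k\}$, where $h(n)$ is the height of the tower factorization of $n$. Then for every integer $k\ge 2$ the natural densities $$c_k=\lim_{N\to\infty}\frac1N\#\{n\le N: h(n)\le k\},\qquad d_k=\lim_{N\to\infty}\frac1N\#\{n\le N: h(n)=k\}$$ exist, and $$c_k=\prod_{p}\Big(1-\frac1p\Big)\Big(1+\sum_{r=1}^\infty\frac{\lambda_{k-1}(r)}{p^r}\Big),\qquad d_k=c_k-c_{k-1},$$ where the product runs over all primes $p$.
   Context: Every integer $n\ge 2$ is written in canonical form $n=p_1^{a_1}\cdots p_r^{a_r}$ with primes $p_1<\cdots<p_r$ and positive integers $a_i$. Factoring each exponent larger than $1$ into prime powers, then doing the same with the new exponents, and so on, gives the tower factorization of $n$; its height $h(n)$ is the number of floors in it. Equivalently, $h(n)=1$ if and only if $n$ is square-free (in particular $h(1)=1$), and if $n$ is not square-free then $h(n)=1+\max\{h(a_i): a_i\ge 2\}$. For example, $h(p^2)=2$ for $p$ prime, and $h(2^{2^{2^2}})=4$. For each integer $k\ge 1$, $\lambda_k$ is the characteristic function of $C_k$: $\lambda_k(n)=1$ if $h(n)\le k$ and $\lambda_k(n)=0$ if $h(n)\ge k+1$ (for positive integers $n$). In particular $c_1=d_1=6/\pi^2$ is the density of the square-free integers. *)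

(* Defs.v *)
From HB Require Import structures.
From mathcomp Require Import all_boot all_order all_algebra.
From mathcomp Require Import all_classical all_reals all_analysis.

Set Implicit Arguments.
Unset Strict Implicit.
Unset Printing Implicit Defensive.

Import Order.TTheory GRing.Theory Num.Theory.
Import numFieldNormedType.Exports.

Local Open Scope classical_set_scope.
Local Open Scope ring_scope.

(* [prime_decomp n] lists the pairs (p_i, a_i) of the canonical form of n.
   Each recursive call adds one floor to the tower and continues with the
   exponents larger than 1; the empty maximum is 0, so square-free numbers
   (including 1) have height 1. As a_i < n, fuel n suffices: see [heightE]. *)
Fixpoint height_rec (fuel n : nat) : nat :=
  if fuel is m.+1 then
    (\max_(f <- prime_decomp n | (1 < f.2)%N) height_rec m f.2).+1
  else 1%N.

(* Meaningful for n >= 1 only; [height 0] is a dummy value. *)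
Definition height (n : nat) : nat := height_rec n n.

Lemma height_rec_stable m m' n :
  (n <= m)%N -> (n <= m')%N -> height_rec m n = height_rec m' n.
Proof.
elim: m m' n => [|m IHm] [|m'] n //=.
- by rewrite leqn0 => /eqP -> _; rewrite big_nil.
- by rewrite leqn0 => _ /eqP ->; rewrite big_nil.
case: n => [|n] nm nm'; first by rewrite !big_nil.
congr _.+1; rewrite big_seq_cond [RHS]big_seq_cond.
apply: eq_bigr => -[p e] /andP[/mem_prime_decomp[p_pr _ /dvdn_leq le_n] _] /=.
have lt_en : (e < n.+1)%N.
  exact: leq_trans (ltn_expl e (prime_gt1 p_pr)) (le_n isT).
by apply: IHm; rewrite -ltnS (leq_trans lt_en).
Qed.

Lemma heightE n : (0 < n)%N ->
  height n = (\max_(f <- prime_decomp n | (1 < f.2)%N) height f.2).+1.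
Proof.
case: n => // n _; rewrite {1}/height /=; congr _.+1.
rewrite big_seq_cond [RHS]big_seq_cond.
apply: eq_bigr => -[p e] /andP[/mem_prime_decomp[p_pr _ /dvdn_leq le_n] _] /=.
apply: height_rec_stable => //; rewrite -ltnS.
exact: leq_trans (ltn_expl e (prime_gt1 p_pr)) (le_n isT).
Qed.

Definition C (k : nat) : pred nat := fun n => (0 < n)%N && (height n <= k)%N.

Definition D (k : nat) : pred nat := fun n => (0 < n)%N && (height n == k).

Definition lambda (R : realType) (k n : nat) : R := (C k n)%:R.

(* #{1 <= n <= N : A n} / N; the term at N = 0 is 0. *)
Definition frequency (R : realType) (A : pred nat) (N : nat) : R :=
  (count A (iota 1 N))%:R / N%:R.

(* Meaningful only when [frequency R A] converges. *)
Definition density (R : realType) (A : pred nat) : R := limn (frequency R A).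

(* The local factor at p whose inner sum runs over the r with h(r) <= j. *)
Definition euler_factor (R : realType) (j p : nat) : R :=
  (1 - p%:R^-1) *
  (1 + limn (fun n : nat => \sum_(1 <= r < n) lambda R j r / p%:R ^+ r)).

(* Main.v *)
Require Import Defs.
From HB Require Import structures.
From mathcomp Require Import all_boot all_order all_algebra.
From mathcomp Require Import all_classical all_reals all_analysis.
From mathcomp Require Import lra ring.

Import Order.TTheory GRing.Theory Num.Theory.
Import numFieldNormedType.Exports.

Local Open Scope classical_set_scope.
Local Open Scope ring_scope.

(** An integer has height at most [k] exactly when each exponent of its
    canonical form is at most 1 or has height at most [k - 1]
    ([C_exponents_in]). The theorem is thus an instance of a density theorem
    for the set [S] of the positive integers whose exponents all lie in a given
    set [E] containing 0 and 1 ([cvg_frequency_exponents_in]).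

    Let [S_y] be defined by the same condition at the primes below [y] only.
    If [y = p] is prime, then [S_p] is stable under multiplication and division
    by [p]. Hence, when [S_p] has density [d], its elements of [p]-adic
    valuation [r] are the [p ^ r * m] with [m] in [S_p] prime to [p], and have
    density [d * (1 - 1/p) / p ^ r]. Summing over the [r < M] in [E] and letting
    [M] tend to infinity shows that [S_(p+1)] has density [d] times the Euler
    factor at [p]; here the neglected integers are multiples of [p ^ M], of
    frequency at most [1 / p ^ M]. By induction, the density of [S_y] is the
    product of the Euler factors below [y].

    As 0 and 1 belong to [E], an element of [S_y] outside [S] is divisible by
    the square of a prime [p >= y]. Such integers have frequency [O(1 / y)],
    uniformly in the range of the count, so that [y] can tend to infinity.

    Both passages to the limit rest on the interchange lemma
    [cvg_interchange], which also yields the existence of the limits. For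
    heights, the case [k = 1] corresponds to [E = {0, 1}]; the density of the
    integers of height exactly [k] is obtained by subtraction. *)

(** * Interchange of limits *)

(** If [u_ M] tends to [l M] for each [M] and approximates [u] within [e M]
    uniformly, with [e] tending to 0, then [u] converges and [l] tends to its
    limit. *)
Lemma cvg_interchange (R : realType) (u_ : nat -> nat -> R) (u l e : nat -> R) :
  (forall M, u_ M @ \oo --> l M) ->
  (forall M N, `|u N - u_ M N| <= e M) ->
  e @ \oo --> (0 : R) ->
  cvgn u /\ l @ \oo --> limn u.
Proof.
move=> u_l u_e e0.
have cvu : cvgn u.
  apply/cauchy_cvgP; apply: cauchy_exP => eps eps0.
  have eps20 : 0 < eps / 2 by lra.
  have [M _ /(_ M (leqnn M)) eM] := (iffLR (cvgrPdist_lt _ _) e0) _ eps20.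
  exists (l M); suff : \forall N \near \oo, ball (l M) eps (u N) by [].
  near=> N; rewrite /ball /=.
  have uM : `|l M - u_ M N| < eps / 2.
    by near: N; exact: (iffLR (cvgrPdist_lt _ _) (u_l M) _ eps20).
  rewrite sub0r normrN in eM.
  have -> : l M - u N = (l M - u_ M N) - (u N - u_ M N) by ring.
  rewrite (le_lt_trans (ler_normB _ _))//.
  have := u_e M N; have := ler_norm (e M); lra.
split=> //.
apply/cvgrPdist_le => eps eps0; near=> M.
have eM : `|0 - e M| <= eps.
  by near: M; exact: (iffLR (cvgrPdist_le _ _) e0 _ eps0).
apply: (@le_trans _ _ (e M)); last first.
  by apply: le_trans (ler_norm _) _; move: eM; rewrite sub0r normrN.
have cv : `|u N - u_ M N| @[N --> \oo] --> `|limn u - l M|.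
  by apply: cvg_norm; exact: cvgB cvu (u_l M).
by apply: (cvgr_to_le cv); apply: nearW => N; exact: u_e.
Unshelve. all: by end_near. Qed.

(** * Counting and frequencies *)

(** The multiples [q * m <= N] of [q] with [m] in [B] correspond to the
    elements of [B] up to [N / q]. *)
Lemma count_dilation (B : pred nat) (q N : nat) : (0 < q)%N ->
  count (fun n => (q %| n)%N && B (n %/ q)%N) (iota 1 N) =
  count B (iota 1 (N %/ q)).
Proof.
have iota1S m : iota 1 m.+1 = iota 1 m ++ [:: m.+1].
  by rewrite -[m.+1 in LHS]addn1 iotaD add1n.
move=> q0; elim: N => [|N IHN]; first by rewrite div0n.
rewrite iota1S count_cat IHN /= addn0 divnS//.
case: (boolP (q %| N.+1)%N) => [|_]; last by rewrite add0n addn0.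
by rewrite add1n iota1S count_cat /= addn0.
Qed.

Section Frequency.
Context {R : realType}.
Implicit Types A B G : pred nat.

Lemma eq_frequency A B N :
  (forall n, (0 < n)%N -> (n <= N)%N -> A n = B n) ->
  frequency R A N = frequency R B N.
Proof.
move=> AB; rewrite /frequency; congr (_%:R / _); apply: eq_in_count => n.
by rewrite mem_iota add1n ltnS => /andP[]; exact: AB.
Qed.

Lemma le_frequency A B N : (forall n, (0 < n)%N -> A n -> B n) ->
  frequency R A N <= frequency R B N.
Proof.
move=> AB; rewrite /frequency ler_wpM2r ?invr_ge0// ler_nat.
rewrite (@eq_in_count _ A (predI A B)); last first.
  move=> n; rewrite mem_iota /= => /andP[n0 _].
  by case An: (A n) => //=; rewrite AB.
by apply: sub_count => n /andP[].
Qed.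

Lemma frequencyU A B N : (forall n, ~~ (A n && B n)) ->
  frequency R (predU A B) N = frequency R A N + frequency R B N.
Proof.
move=> AB; rewrite /frequency -mulrDl -natrD -count_predUI.
rewrite (@eq_count _ (predI A B) pred0) ?count_pred0 ?addn0// => n.
exact/negbTE/AB.
Qed.

Lemma cvg_frequency_pred0 A :
  (forall n, ~~ A n) -> frequency R A @ \oo --> (0 : R).
Proof.
move=> A0; have -> : frequency R A = fun=> 0.
  apply/funext => N; rewrite /frequency (@eq_count _ A pred0).
    by rewrite count_pred0 mul0r.
  by move=> n; exact/negbTE/A0.
exact: cvg_cst.
Qed.

(** The frequencies of [A] and of a larger set [B] differ by at most the
    frequency of any set containing the difference. *)
Lemma frequencyB_le A B G N :
  (forall n, A n -> B n) -> (forall n, (0 < n)%N -> B n -> ~~ A n -> G n) ->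
  `|frequency R B N - frequency R A N| <= frequency R G N.
Proof.
move=> AB BG.
have -> : frequency R B N =
    frequency R A N + frequency R (predI B (predC A)) N.
  rewrite -frequencyU => [|n /=]; last by case: (A n); rewrite ?andbF.
  apply: eq_frequency => n _ _ /=.
  by have := AB n; case: (A n) => [->|]//=; rewrite ?andbT.
rewrite addrC addKr ger0_norm ?divr_ge0//.
by apply: le_frequency => n n0 /andP[]; exact: BG.
Qed.

(** The multiples of [q] have frequency at most [1 / q]. *)
Lemma frequency_dvdn_le q N : (0 < q)%N ->
  frequency R (fun n => q %| n)%N N <= q%:R^-1.
Proof.
move=> q0; rewrite /frequency.
rewrite (@eq_count _ _ (fun n => (q %| n)%N && predT (n %/ q)%N)); last first.
  by move=> n /=; rewrite andbT.
rewrite count_dilation// count_predT size_iota.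
case: (posnP N) => [->|N0]; first by rewrite invr0 mulr0 invr_ge0.
rewrite ler_pdivrMr ?ltr0n// mulrC ler_pdivlMr ?ltr0n//.
by rewrite -natrM ler_nat leq_trunc_div.
Qed.

Lemma cvg_divn_ratio q : (0 < q)%N ->
  (fun N => (N %/ q)%:R / N%:R : R) @ \oo --> (q%:R^-1 : R).
Proof.
move=> q0; apply/cvgrPdist_le => eps eps0.
have [K _ HK] := iffLR (cvgrPdist_le _ _) (@cvg_harmonic R) _ eps0.
near=> N.
have N0 : (0 < N)%N by near: N; exact: nbhs_infty_gt.
have NR : 0 < N%:R :> R by rewrite ltr0n.
have qR : 0 < q%:R :> R by rewrite ltr0n.
have -> : q%:R^-1 - (N %/ q)%:R / N%:R = (N %% q)%:R / (q%:R * N%:R) :> R.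
  have : N%:R = (N %/ q)%:R * q%:R + (N %% q)%:R :> R.
    by rewrite -natrM -natrD -divn_eq.
  move=> NE; have -> : (N %% q)%:R = N%:R - (N %/ q)%:R * q%:R :> R by lra.
  by field; rewrite !lt0r_neq0.
rewrite ger0_norm ?divr_ge0 ?mulr_ge0//.
rewrite (@le_trans _ _ N%:R^-1)//.
  rewrite ler_pdivrMr ?mulr_gt0// mulrCA mulVf ?lt0r_neq0// mulr1.
  by rewrite ler_nat ltnW// ltn_pmod.
near: N; exists K.+1 => //= n Kn.
have n0 : (0 < n)%N by exact: leq_trans Kn.
have := HK n.-1; rewrite /= -ltnS prednK// => /(_ Kn).
by rewrite sub0r normrN ger0_norm// invr_ge0.
Unshelve. all: by end_near. Qed.

(** If [A] has density [a], then [q * A] has density [a / q]. *)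
Lemma cvg_frequency_dilation A (a : R) q : (0 < q)%N ->
  frequency R A @ \oo --> a ->
  frequency R (fun n => (q %| n)%N && A (n %/ q)%N) @ \oo --> a / q%:R.
Proof.
move=> q0 Aa.
have divn_oo : (fun N => N %/ q)%N @ \oo --> \oo.
  move=> S [K _ KS]; exists (K * q)%N => //= N; rewrite /= => KN.
  by apply: KS; rewrite /= leq_divRL.
have : frequency R A (N %/ q)%N * ((N %/ q)%:R / N%:R) @[N --> \oo] -->
    a / q%:R.
  exact: cvgM (cvg_comp _ _ divn_oo Aa) (cvg_divn_ratio q q0).
apply: cvg_trans; apply: near_eq_cvg; near=> N => /=.
rewrite /frequency count_dilation//=.
have Nq0 : (0 < N %/ q)%N by rewrite divn_gt0//; near: N; exact: nbhs_infty_ge.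
by rewrite mulrA divfK// pnatr_eq0 -lt0n //.
Unshelve. all: by end_near. Qed.

End Frequency.

(** * Prescribing the exponent of one prime *)

(** The Euler factor at [p] of the integers whose exponents satisfy [E]; the
    term of exponent 0 is the leading 1. *)
Definition local_factor (R : realType) (E : pred nat) (p : nat) : R :=
  (1 - p%:R^-1) *
  (1 + limn (fun n : nat => \sum_(1 <= r < n) (E r)%:R / p%:R ^+ r : R)).

(** The inner series of the Euler factor at [p], with its term of exponent 0
    put back. *)
Lemma cvg_local_series (R : realType) (E : pred nat) (p : nat) :
  prime p -> E 0 ->
  (fun n => \sum_(0 <= r < n) (E r)%:R / p%:R ^+ r : R) @ \oo -->
  1 + limn (fun n : nat => \sum_(1 <= r < n) (E r)%:R / p%:R ^+ r : R).
Proof.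
move=> p_pr E0; pose v r : R := (E r)%:R / p%:R ^+ r.
have p1 : 1 < p%:R :> R by rewrite ltr1n prime_gt1.
have cvg_v : cvgn (series v).
  apply: (@series_le_cvg R v (geometric 1 p%:R^-1)) => [n|n|n|].
  - by rewrite divr_ge0 ?exprn_ge0.
  - by rewrite /= mul1r exprn_ge0// invr_ge0.
  - rewrite /= mul1r exprVn -[leRHS]mul1r ler_wpM2r ?invr_ge0 ?exprn_ge0//.
    by case: (E n).
  - by apply: is_cvg_geometric_series; rewrite ger0_norm ?invr_ge0// invf_lt1//; lra.
have cvg_v1 : cvgn (fun n : nat => \sum_(1 <= r < n) v r).
  by rewrite (is_cvg_series_restrict 1 v).
have cvg_t : (fun n : nat => \sum_(1 <= r < n) v r) @ \oo -->
    limn (fun n : nat => \sum_(1 <= r < n) v r) by exact: cvg_v1.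
rewrite -cvg_shiftS in cvg_t; rewrite -cvg_shiftS.
have -> : [sequence \sum_(0 <= r < n.+1) (E r)%:R / p%:R ^+ r]_n =
    (fun n => 1 + \sum_(1 <= r < n.+1) v r).
  by apply/funext => n /=; rewrite big_ltn// E0 expr0 divr1.
exact: cvgD (cvg_cst _) cvg_t.
Qed.

Section OnePrime.
Context {R : realType} (A : pred nat) (p : nat) (d : R).
Hypothesis p_pr : prime p.
Hypothesis A_mulp : forall m, A (p * m)%N = A m.
Hypothesis A_d : frequency R A @ \oo --> d.

Let p0 : (0 < p)%N. Proof. exact: prime_gt0. Qed.

(** The elements of [A] divisible by [p] form [p * A], of density [d / p]. *)
Lemma cvg_frequency_coprime :
  frequency R (fun n => A n && ~~ (p %| n)%N) @ \oo --> d * (1 - p%:R^-1).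
Proof.
rewrite mulrBr mulr1.
apply: cvg_trans (cvgB A_d (cvg_frequency_dilation A d p p0 A_d)).
apply: near_eq_cvg; apply: nearW => N /=.
rewrite [LHS]/(_ - _); apply/eqP; rewrite subr_eq -frequencyU; last first.
  by move=> n; case: (p %| n)%N; rewrite /= ?andbF.
apply/eqP/eq_frequency => n _ _ /=.
case: (boolP (p %| n)%N) => [/dvdnP[m ->]|]; last by rewrite andbT orbF.
by rewrite mulnK// mulnC A_mulp andbF.
Qed.

(** The elements of [A] of [p]-adic valuation [r] are the products by [p ^ r]
    of its elements prime to [p]. *)
Lemma cvg_frequency_logn r :
  frequency R (fun n => A n && (logn p n == r)) @ \oo -->
  d * (1 - p%:R^-1) / p%:R ^+ r.
Proof.
have pr0 : (0 < p ^ r)%N by rewrite expn_gt0 p0.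
rewrite -natrX.
apply: cvg_trans (cvg_frequency_dilation _ _ _ pr0 cvg_frequency_coprime).
apply: near_eq_cvg; apply: nearW => N; apply: eq_frequency => n n0 _.
have A_mulpX m : A (m * p ^ r)%N = A m.
  by elim: r {pr0} m => [|r IHr] m; rewrite ?muln1// expnS mulnCA A_mulp IHr.
case: (boolP (p ^ r %| n)%N) n0 => [/dvdnP[m ->]|ndvd n0] /=.
  rewrite muln_gt0 => /andP[m0 _]; rewrite mulnK// A_mulpX lognM// pfactorK//.
  by rewrite -[X in _ == X]add0n eqn_add2r eqn0Ngt logn_gt0 mem_primes p_pr m0.
case: eqP => [nr|_]; last by rewrite andbF.
by rewrite pfactor_dvdn// nr leqnn in ndvd.
Qed.

Lemma cvg_frequency_logn_lt (E : pred nat) M :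
  frequency R (fun n => A n && E (logn p n) && (logn p n < M)%N) @ \oo -->
  d * ((1 - p%:R^-1) * \sum_(0 <= r < M) (E r)%:R / p%:R ^+ r).
Proof.
elim: M => [|M IHM].
  by rewrite big_nil !mulr0; apply: cvg_frequency_pred0 => n; rewrite andbF.
rewrite big_nat_recr//= !mulrDr.
have EM : frequency R (fun n => A n && E M && (logn p n == M)) @ \oo -->
    d * ((1 - p%:R^-1) * ((E M)%:R / p%:R ^+ M)).
  case: (E M).
    have -> : (fun n => A n && true && (logn p n == M)) =
        (fun n => A n && (logn p n == M)) by apply/funext => n; rewrite andbT.
    rewrite mul1r mulrA; exact: cvg_frequency_logn.
  by rewrite mul0r !mulr0; apply: cvg_frequency_pred0 => n; rewrite andbF.
apply: cvg_trans (cvgD IHM EM).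
apply: near_eq_cvg; apply: nearW => N /=.
apply: etrans (esym (frequencyU _ _ N _)) _ => [n|].
  by case: ltngtP; rewrite ?andbF.
apply: eq_frequency => n _ _ /=; rewrite ltnS.
by case: ltngtP => // [||->]; rewrite ?andbF ?andbT ?orbF.
Qed.

Lemma cvg_frequency_prime (E : pred nat) : E 0 ->
  frequency R (fun n => A n && E (logn p n)) @ \oo --> d * local_factor R E p.
Proof.
move=> E0; have p1 : 1 < p%:R :> R by rewrite ltr1n prime_gt1.
have [M N||cvf lim] := @cvg_interchange R _
    (frequency R (fun n => A n && E (logn p n))) _ (fun M => p%:R^-1 ^+ M)
    (cvg_frequency_logn_lt E).
- (* The elements of valuation at least [M] are multiples of [p ^ M]. *)
  rewrite exprVn -natrX.
  have pM0 : (0 < p ^ M)%N by rewrite expn_gt0 p0.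
  apply: le_trans (frequency_dvdn_le (p ^ M) N pM0).
  apply: frequencyB_le => [n /andP[]//|n n0 -> /=].
  by rewrite -leqNgt pfactor_dvdn.
- by apply: cvg_expr; rewrite ger0_norm ?invr_ge0// invf_lt1//; lra.
suff <- : limn (frequency R (fun n => A n && E (logn p n))) =
  d * local_factor R E p by [].
apply: cvg_unique lim _ => //.
by apply: cvgMl_tmp; apply: cvgMl_tmp; exact: cvg_local_series.
Qed.

End OnePrime.

(** * Prescribing the exponents of all primes *)

(** The positive integers whose exponent at each prime below [y] satisfies
    [E]. The range also contains non-primes, at which [logn] is 0; they impose
    nothing when [E 0] holds. *)
Definition exponents_below (E : pred nat) (y : nat) : pred nat :=
  fun n => (0 < n)%N && all (fun p => E (logn p n)) (iota 0 y).

(** The positive integers all of whose exponents satisfy [E]: the primes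
    dividing [n] are at most [n]. *)
Definition exponents_in (E : pred nat) : pred nat :=
  fun n => exponents_below E n.+1 n.

Lemma exponents_belowS E y n :
  exponents_below E y.+1 n = exponents_below E y n && E (logn y n).
Proof.
by rewrite /exponents_below -[y.+1]addn1 iotaD all_cat /= andbT andbA.
Qed.

Lemma exponents_below_mulp E p m :
  prime p -> exponents_below E p (p * m) = exponents_below E p m.
Proof.
move=> p_pr; rewrite /exponents_below muln_gt0 prime_gt0//=.
case: posnP => //= m0; apply: eq_in_all => q.
rewrite mem_iota add0n => /andP[_ qp].
by rewrite lognM ?(prime_gt0 p_pr)// logn_prime// ltn_eqF.
Qed.

Lemma exponents_below_in (E : pred nat) y n : E 0 -> (n < y)%N ->
  exponents_below E y n = exponents_in E n.
Proof.
move=> E0 ny; rewrite /exponents_in /exponents_below -(subnKC ny) iotaD all_cat.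
rewrite [X in _ && (_ && X)](_ : _ = true) ?andbT//.
by apply/allP => p; rewrite mem_iota => /andP[np _]; rewrite ltn_log0.
Qed.

Section AllPrimes.
Context {R : realType} (E : pred nat).
Hypotheses (E0 : E 0) (E1 : E 1).

Lemma cvg_frequency_below y :
  frequency R (exponents_below E y) @ \oo -->
  \prod_(0 <= p < y | prime p) local_factor R E p.
Proof.
elim: y => [|y IHy].
  rewrite big_nil -cvg_shiftS.
  have -> : [sequence frequency R (exponents_below E 0) N.+1]_N = fun=> 1.
    apply/funext => N; rewrite /= /frequency.
    rewrite (@eq_in_count _ _ predT) => [|n]; last first.
      by rewrite mem_iota /exponents_below /= => /andP[->].
    by rewrite count_predT size_iota divff// pnatr_eq0.
  exact: cvg_cst.
rewrite big_mkcond big_nat_recr//= -big_mkcond.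
have -> : exponents_below E y.+1 =
    (fun n => exponents_below E y n && E (logn y n)).
  by apply/funext => n; rewrite exponents_belowS.
case: ifPn => [y_pr|y_npr].
  apply: cvg_frequency_prime => // m; exact: exponents_below_mulp.
rewrite mulr1.
have -> // : (fun n => exponents_below E y n && E (logn y n)) =
  exponents_below E y.
by apply/funext => n; rewrite lognE (negbTE y_npr) E0 andbT.
Qed.

(** Imposing the condition at a prime [y] only removes multiples of [y ^ 2],
    and [1 / y ^ 2 <= 3 / ((y + 1) (y + 2))] for [y >= 2]. The bound is written
    as a difference so that it telescopes. *)
Lemma frequency_belowS_le y N :
  `|frequency R (exponents_below E y.+1) N - frequency R (exponents_below E y) N|
  <= 3 * (y.+1%:R^-1 - y.+2%:R^-1).
Proof.
rewrite distrC; set b := 3 * _.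
have yR : 0 <= y%:R :> R by [].
have bE : b = 3 / ((y%:R + 1) * (y%:R + 2)).
  rewrite /b -[y.+2]addn2 -[y.+1]addn1 !natrD; field.
  by apply/andP; split; apply: lt0r_neq0; lra.
case: (boolP (prime y)) => [y_pr|y_npr].
  have y2 : 2 <= y%:R :> R by rewrite ler_nat prime_gt1.
  apply: (@le_trans _ _ (y ^ 2)%:R^-1).
    have y20 : (0 < y ^ 2)%N by rewrite expn_gt0 prime_gt0.
    apply: le_trans (frequency_dvdn_le (y ^ 2) N y20).
    apply: frequencyB_le => [n|n n0 yn].
      by rewrite exponents_belowS => /andP[].
    rewrite exponents_belowS yn pfactor_dvdn//=.
    by case: (logn y n) => [|[|]]; rewrite ?E0 ?E1.
  rewrite bE ler_pdivlMr; last nra.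
  rewrite mulrC natrX ler_pdivrMr; nra.
rewrite [X in `|X - _|](_ : _ = frequency R (exponents_below E y.+1) N).
  rewrite subrr normr0 bE divr_ge0//; nra.
apply: eq_frequency => n _ _.
by rewrite exponents_belowS lognE (negbTE y_npr) E0 andbT.
Qed.

(** The bound is uniform in [N]. *)
Lemma frequency_below_le y N :
  `|frequency R (exponents_in E) N - frequency R (exponents_below E y) N|
  <= 3 * y.+1%:R^-1.
Proof.
(* Up to [N] the conditions at [p > N] are void, so that finitely many steps
   lead from [y] to the full condition. *)
have -> : frequency R (exponents_in E) N =
    frequency R (exponents_below E (y + N.+1)) N.
  apply: eq_frequency => n _ nN; rewrite exponents_below_in//.
  by rewrite (leq_trans _ (leq_addl _ _)).
have H k : `|frequency R (exponents_below E (y + k)) N -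
             frequency R (exponents_below E y) N|
    <= 3 * (y.+1%:R^-1 - (y + k).+1%:R^-1).
  elim: k => [|k IHk]; first by rewrite addn0 !subrr normr0 mulr0.
  rewrite addnS; have := frequency_belowS_le (y + k) N.
  move: IHk; set a := frequency _ _ _; set b := frequency _ _ _.
  set c := frequency _ _ _.
  have := ler_normD (c - a) (a - b); rewrite addrA subrK.
  move: y.+1%:R^-1 (y + k).+1%:R^-1 (y + k).+2%:R^-1 => s t u; lra.
apply: le_trans (H _) _; rewrite ler_wpM2l// lerBlDr lerDl invr_ge0//.
Qed.

(** The integers whose exponents all belong to [E] have a density, which is
    the product of the Euler factors of [E]. *)
Lemma cvg_frequency_exponents_in :
  cvgn (frequency R (exponents_in E)) /\
  (fun y => \prod_(0 <= p < y | prime p) local_factor R E p) @ \oo -->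
    density R (exponents_in E).
Proof.
apply: (@cvg_interchange R _ _ _ (fun y => 3 * harmonic y)
          cvg_frequency_below frequency_below_le).
by rewrite -[X in _ --> X](mulr0 3); apply: cvgMl_tmp; exact: cvg_harmonic.
Qed.

End AllPrimes.

(** * Heights *)

(** The exponents of the integers of height at most [j.+1]. The alternative
    [r <= 1] is needed for exponent 0, and for exponent 1 when [j = 0]. *)
Definition height_exponents (j : nat) : pred nat :=
  fun r => (r <= 1)%N || C j r.

Lemma C_exponents_in j : C j.+1 = exponents_in (height_exponents j).
Proof.
apply/funext => n; rewrite /C /exponents_in /exponents_below.
case: (posnP n) => [//|n0]; rewrite !andTb heightE// ltnS.
apply/bigmax_leqP_seq/allP => [H p _|H [p e]].
  rewrite /height_exponents /C; case: (leqP (logn p n) 1) => //= lt1.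
  rewrite (ltnW lt1)/=.
  apply: (H (p, logn p n)) => //; rewrite prime_decompE; apply: map_f.
  by rewrite -logn_gt0 ltnW.
rewrite prime_decompE => /mapP[q q_n [-> ->]] /= lt1.
have : q \in iota 0 n.+1.
  move: q_n; rewrite mem_primes mem_iota ltnS => /and3P[_ _ /dvdn_leq]; exact.
by move=> /H; rewrite /height_exponents leqNgt lt1 => /andP[].
Qed.

Lemma frequency_D (R : realType) j N :
  frequency R (D j.+1) N = frequency R (C j.+1) N - frequency R (C j) N.
Proof.
apply/eqP; rewrite eq_sym subr_eq -frequencyU => [|n]; last first.
  by rewrite /D /C; case: eqP => [->|]; rewrite ?ltnn ?andbF.
apply/eqP/eq_frequency => n n0 _; rewrite /= /C /D n0 /=.
by rewrite leq_eqVlt ltnS.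
Qed.

(** For [j > 0] the exponent 1 has height at most [j], so that for positive
    exponents [height_exponents j] agrees with [C j]. *)
Lemma local_factor_height (R : realType) j p : (0 < j)%N ->
  local_factor R (height_exponents j) p = euler_factor R j p.
Proof.
move=> j0; rewrite /local_factor /euler_factor; congr (_ * (1 + _)).
congr (lim (_ @ \oo)).
apply/funext => n; rewrite big_nat_cond [RHS]big_nat_cond; apply: eq_bigr => r.
rewrite andbT => /andP[r0 _]; rewrite /lambda /height_exponents.
case: (leqP r 1) => //= r1; have -> : r = 1 by apply/eqP; rewrite eqn_leq r1.
by rewrite /C /height /= big_nil j0.
Qed.

Theorem mainTheorem1 (R : realType) (k : nat) (hk : (2 <= k)%N) :
  [/\ cvgn (frequency R (C k)),
      cvgn (frequency R (D k)),
      (fun N : nat => \prod_(0 <= p < N | prime p) euler_factor R k.-1 p)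
        @ \oo --> density R (C k)
    & density R (D k) = density R (C k) - density R (C k.-1)].
Proof.
case: k hk => [|[|j]] // _; rewrite -[j.+2.-1]/j.+1.
have C_density i : cvgn (frequency R (C i.+1)) /\
    (fun y => \prod_(0 <= p < y | prime p) local_factor R (height_exponents i) p)
      @ \oo --> density R (C i.+1).
  by rewrite C_exponents_in; exact: cvg_frequency_exponents_in.
have [cvgC prodC] := C_density j.+1; have [cvgC' _] := C_density j.
have DE : frequency R (D j.+2) = frequency R (C j.+2) - frequency R (C j.+1).
  by apply/funext => N; exact: frequency_D.
split=> //.
- by rewrite DE; exact: is_cvgB.
- by under eq_fun do under eq_bigr do rewrite -local_factor_height//.
- by rewrite /density DE limB.
Qed.
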